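(* Let $A$ be either $\Bbbk_q[u,v]$ with $q\in\Bbbk^\times$, $q\ne1$, and $G=\frac1n(1,a)$ with $1\le a<n$, $\gcd(a,n)=1$; or $A=\Bbbk_J[u,v]$ and $G=\frac1n(1,1)$ with $n\ge2$. Let $\overline g=\sum_{g\in G}g\in A\# G$. Then $(A\# G)/\langle\overline g\rangle$ is finite dimensional over $\Bbbk$; consequently the Auslander map $\phi:A\#G\to\mathrm{End}_{A^G}(A)$, $\phi(ag)(b)=a(g\cdot b)$, is an isomorphism.
   Context: $\Bbbk$ is algebraically closed of characteristic $0$; $\omega_n$ is a primitive $n$th root of unity. $\Bbbk_q[u,v]=\Bbbk\langle u,v\rangle/(vu-quv)$, $\Bbbk_J[u,v]=\Bbbk\langle u,v\rangle/(vu-uv-u^2)$. A matrix $\begin{pmatrix}a&b\\c&d\end{pmatrix}$ acts by $u\mapsto au+cv$, $v\mapsto bu+dv$; $\frac1n(1,a)$ is the cyclic group generated by $\mathrm{diag}(\omega_n,\omega_n^a)$. $A\#G$ is the skew group (smash product) algebra $A\otimes\Bbbk G$ with multiplication $(ag)(bh)=a(g\cdot b)gh$; $\langle\overline g\rangle$ is the two-sided ideal generated by $\overline g$; $A^G$ is the invariant ring. *)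

(* Defs.v *)
From HB Require Import structures.
From mathcomp Require Import all_boot all_order all_algebra.
Set Implicit Arguments. Unset Strict Implicit. Unset Printing Implicit Defensive.
Import Order.TTheory GRing.Theory Num.Theory.
Local Open Scope ring_scope.

(* A k-algebra A together with u, v : A is a presentation of the algebra
   k<u,v>/(rel u v), expressed by the universal property of that quotient:
   rel holds for (u,v), and for every k-algebra B and x,y : B satisfying rel
   there is exactly one (unital) k-algebra morphism A -> B with u |-> x, v |-> y. *)
Definition presented_by (k : fieldType) (A : algType k)
  (rel : forall B : algType k, B -> B -> Prop) (u v : A) : Prop :=
  rel A u v /\
  forall (B : algType k) (x y : B), rel B x y ->
    (exists f : {lrmorphism A -> B}, f u = x /\ f v = y) /\
    (forall f g : {lrmorphism A -> B}, f u = g u -> f v = g v -> f =1 g).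

Definition qplane_rel (k : fieldType) (q : k) (B : algType k) (x y : B) : Prop :=
  y * x = q *: (x * y).

Definition jplane_rel (k : fieldType) (B : algType k) (x y : B) : Prop :=
  y * x = x * y + x * x.

(* Skew group algebra A # G for the cyclic group G = {sigma^i | i < n}
   (sigma an automorphism of order n).  An element sum_i a_i g^i, g = sigma,
   is represented by the finite function i |-> a_i. *)

Definition skew_one (k : fieldType) (A : algType k) (n : nat) : {ffun 'I_n -> A} :=
  [ffun i : 'I_n => if val i == 0%N then 1 else 0].

(* (a g^i)(b g^j) = a sigma^i(b) g^(i+j mod n) *)
Definition skew_mul (k : fieldType) (A : algType k) (n : nat) (sigma : A -> A)
  (f h : {ffun 'I_n -> A}) : {ffun 'I_n -> A} :=
  [ffun l : 'I_n => \sum_(i < n) \sum_(j < n | ((i + j) %% n)%N == l)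
                      f i * iter i sigma (h j)].

Definition gbar (k : fieldType) (A : algType k) (n : nat) : {ffun 'I_n -> A} :=
  [ffun _ => 1].

Definition in_gbar_ideal (k : fieldType) (A : algType k) (n : nat)
  (sigma : A -> A) (z : {ffun 'I_n -> A}) : Prop :=
  exists s : seq ({ffun 'I_n -> A} * {ffun 'I_n -> A}),
    z = \sum_(p <- s) skew_mul sigma (skew_mul sigma p.1 (gbar A n)) p.2.

Definition quotient_fin_dim (k : fieldType) (A : algType k) (n : nat)
  (sigma : A -> A) : Prop :=
  exists s : seq {ffun 'I_n -> A},
    forall z : {ffun 'I_n -> A}, exists c : 'I_(size s) -> k,
      in_gbar_ideal sigma (z - \sum_(i < size s) c i *: s`_i).

Definition auslander (k : fieldType) (A : algType k) (n : nat)
  (sigma : A -> A) (f : {ffun 'I_n -> A}) (b : A) : A :=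
  \sum_(i < n) f i * iter i sigma b.

Definition AG_endo (k : fieldType) (A : algType k) (sigma : A -> A) (h : A -> A) : Prop :=
  (forall x y, h (x + y) = h x + h y) /\
  (forall x c, sigma c = c -> h (x * c) = h x * c).

Definition auslander_iso (k : fieldType) (A : algType k) (n : nat)
  (sigma : A -> A) : Prop :=
  (forall f : {ffun 'I_n -> A}, AG_endo sigma (auslander sigma f)) /\
  (forall f h : {ffun 'I_n -> A}, auslander sigma (f + h) =1 (fun b => auslander sigma f b + auslander sigma h b)) /\
  (forall f h : {ffun 'I_n -> A}, auslander sigma (skew_mul sigma f h) =1 auslander sigma f \o auslander sigma h) /\
  auslander sigma (skew_one A n) =1 id /\
  (forall f h : {ffun 'I_n -> A}, auslander sigma f =1 auslander sigma h -> f = h) /\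
  (forall h, AG_endo sigma h -> exists f : {ffun 'I_n -> A}, auslander sigma f =1 h).

(* Main.v *)
(* Both algebras are Ore extensions k[u][v; s, d] in which u is a regular normal
   element (uA = Au), v is regular modulo u, and the monomials u^i v^j form a basis.

   The ideal generated by gbar contains b c e for every b and every c of weight s,
   where e is the idempotent of the character s of G.  A monomial u^i v^j with
   i >= n or j >= n has right factors of every weight, so it lies in the ideal, and
   the quotient is spanned by the u^i v^j g^l with i, j, l < n.

   Evaluating at the powers of u and inverting the discrete Fourier transform gives
   the injectivity of the Auslander map.  For surjectivity, it suffices that an
   A^G-linear map h is left multiplication by some F on the elements of weight s.
   Take v^m of weight s and write v^m u^s = u^s y; linearity yields
   h(v^m) u^s = h(u^s) y, and y is regular modulo u, so h(u^s) = F u^s.  For any b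
   of weight s, b u^s = u^s c then gives h(b) u^s = h(u^s) c = F b u^s. *)

Require Import Defs.
From HB Require Import structures.
From mathcomp Require Import all_boot all_order all_algebra.
Import GRing.Theory.
Local Open Scope ring_scope.
Set Implicit Arguments. Unset Strict Implicit. Unset Printing Implicit Defensive.

(** * Roots of unity *)

Section RootOfUnitySums.

Variables (k : fieldType) (n : nat) (w : k).
Hypothesis w_prim : n.-primitive_root w.

Lemma prim_root_neq0 : w != 0.
Proof.
apply/eqP=> w0; have /eqP := prim_expr_order w_prim.
by rewrite w0 expr0n eqn0Ngt (prim_order_gt0 w_prim) eq_sym oner_eq0.
Qed.

(** Orthogonality of the characters of the cyclic group: for [i != j] this is a geometric sum whose
    ratio is an nth root of unity other than 1. *)
Lemma sum_prim_root (i j : 'I_n) :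
  \sum_(l < n) w ^+ (l * i) / w ^+ (l * j) = (n%:R *+ (i == j)) :> k.
Proof.
have wX0 m : w ^+ m != 0 by rewrite expf_neq0 ?prim_root_neq0.
pose x := w ^+ i / w ^+ j.
rewrite (eq_bigr (fun l : 'I_n => x ^+ l)) => [|l _]; last first.
  by rewrite expr_div_n -!exprM ![(l * _)%N]mulnC.
have [eq_ij|neq_ij] := eqVneq i j.
  rewrite (eq_bigr (fun=> 1)) => [|l _]; first by rewrite sumr_const card_ord.
  by rewrite /x eq_ij divff ?expr1n.
have x1 : x - 1 != 0.
  rewrite subr_eq0 /x; apply: contra neq_ij => /eqP xE; apply/eqP/val_inj.
  have/eqP : w ^+ i = w ^+ j by rewrite -[LHS](divfK (wX0 j)) xE mul1r.
  by rewrite (eq_prim_root_expr w_prim) !modn_small // => /eqP.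
(* Multiplying by [x - 1] telescopes the sum to [x ^+ n - 1], which vanishes. *)
apply: (mulfI x1); rewrite -subrX1 mulr0 /x expr_div_n -!exprM ![(_ * n)%N]mulnC.
by rewrite !exprM (prim_expr_order w_prim) !expr1n divr1 subrr.
Qed.

Lemma dft_inv (V : lmodType k) (F : 'I_n -> V) (j : 'I_n) :
  \sum_(s < n) (w ^+ (s * j))^-1 *: (\sum_(i < n) w ^+ (s * i) *: F i) = n%:R *: F j.
Proof.
under eq_bigr do rewrite scaler_sumr.
rewrite exchange_big /= (bigD1 j) //= [X in _ + X]big1 => [|i neq_ij].
  under eq_bigr do rewrite scalerA mulrC.
  by rewrite -scaler_suml sum_prim_root eqxx addr0.
under eq_bigr do rewrite scalerA mulrC.
by rewrite -scaler_suml sum_prim_root (negbTE neq_ij) scale0r.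
Qed.

(** For [a] coprime to [n], [w ^+ a] is again primitive, so its powers exhaust the nth roots of
    unity. With [v] of weight [a], every weight is thus attained by some [v ^+ m] with [m < n]. *)
Lemma exp_coprime_surj (a s : nat) : coprime a n ->
  exists2 m, (m < n)%N & w ^+ (a * m) = w ^+ s.
Proof.
rewrite -(prim_root_exp_coprime _ w_prim) => wa_prim.
have [|m wsE] := prim_rootP wa_prim (x := w ^+ s).
  by rewrite -exprM mulnC exprM (prim_expr_order w_prim) expr1n.
by exists m; rewrite ?exprM.
Qed.

End RootOfUnitySums.

(** * Iterates of an algebra endomorphism *)

Section IterMorphism.

Variables (k : fieldType) (A : algType k) (sigma : {lrmorphism A -> A}) (m : nat).

Lemma iter_lrD : {morph iter m sigma : x y / x + y}.
Proof. by elim: m => // l IH x y; rewrite !iterS IH rmorphD. Qed.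

Lemma iter_lrM : {morph iter m sigma : x y / x * y}.
Proof. by elim: m => // l IH x y; rewrite !iterS IH rmorphM. Qed.

Lemma iter_lrZ c : {morph iter m sigma : x / c *: x}.
Proof. by elim: m => // l IH x; rewrite !iterS IH linearZ. Qed.

Lemma iter_lr0 : iter m sigma 0 = 0.
Proof. by elim: m => // l IH; rewrite iterS IH rmorph0. Qed.

Lemma iter_lr_sum I (r : seq I) (P : pred I) (F : I -> A) :
  iter m sigma (\sum_(i <- r | P i) F i) = \sum_(i <- r | P i) iter m sigma (F i).
Proof. exact: (big_morph _ iter_lrD iter_lr0). Qed.

Lemma iter_weight (c : k) (b : A) : sigma b = c *: b -> iter m sigma b = c ^+ m *: b.
Proof.
move=> sb; elim: m => [|l IH]; first by rewrite scale1r.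
by rewrite iterS IH linearZ /= sb scalerA exprSr.
Qed.

End IterMorphism.

(** * Weight decomposition and the Auslander map *)

Section WeightDecomposition.

Variables (k : fieldType) (A : algType k) (n : nat) (w : k).
Hypothesis w_prim : n.-primitive_root w.
Variable sigma : {lrmorphism A -> A}.
Hypothesis sigma_order : forall b, iter n sigma b = b.

(** The action on [A] of the idempotent $e_s = \frac1n\sum_i w^{-is} g^i$ of the group algebra. *)
Definition weight_proj (s : nat) (b : A) : A :=
  n%:R^-1 *: \sum_(i < n) (w ^+ (i * s))^-1 *: iter i sigma b.

Lemma iter_sigma_mod (m : nat) (b : A) : iter (m %% n) sigma b = iter m sigma b.
Proof.
rewrite {2}(divn_eq m n) addnC iterD; congr (iter _ _ _).
by elim: (m %/ n)%N => // d IH; rewrite mulSn iterD -IH sigma_order.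
Qed.

Lemma weight_proj_weight (s : nat) (b : A) :
  sigma (weight_proj s b) = w ^+ s *: weight_proj s b.
Proof.
rewrite /weight_proj linearZ /= scalerA mulrC -scalerA; congr (_ *: _).
rewrite raddf_sum scaler_sumr.
(* Applying [sigma] moves each summand to the next index; since [G n = G 0], the sum closes up
   cyclically. *)
pose G (i : nat) : A := w ^+ s *: ((w ^+ (i * s))^-1 *: iter i sigma b).
rewrite (eq_bigr (fun i : 'I_n => G i.+1)) => [|i _]; last first.
  rewrite [LHS]linearZ /G iterS /= scalerA; congr (_ *: _).
  by rewrite mulSn exprD invfM mulVKf // expf_neq0 ?(prim_root_neq0 w_prim).
rewrite [RHS](eq_bigr (fun i : 'I_n => G i)) //.
have GnE : G n = G 0%N.
  by rewrite /G sigma_order exprM (prim_expr_order w_prim) expr1n.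
have := prim_order_gt0 w_prim; case: (n) GnE => // m GnE _.
by rewrite big_ord_recr big_ord_recl /= GnE addrC.
Qed.

(** After exchanging the sums, orthogonality in [s] leaves only the term of the identity,
    [i = 0]. *)
Lemma sum_weight_proj (b : A) : \sum_(s < n) weight_proj s b = b.
Proof.
have n0 := prim_order_gt0 w_prim.
rewrite /weight_proj -scaler_sumr exchange_big /=.
have scal0 (i : 'I_n) : \sum_(s < n) (w ^+ (i * s))^-1 *: iter i sigma b
    = (n%:R *+ (Ordinal n0 == i)) *: iter i sigma b.
  rewrite -(sum_prim_root w_prim) scaler_suml; apply: eq_bigr => s _ /=.
  by rewrite muln0 mul1r mulnC.
rewrite (eq_bigr _ (fun i _ => scal0 i)) (bigD1 (Ordinal n0)) //=.
rewrite big1 ?addr0 => [|i /negbTE]; last by rewrite eq_sym => ->; rewrite scale0r.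
by rewrite scalerA mulVf ?scale1r // (prim_root_natf_neq0 w_prim).
Qed.

Lemma auslander_AG_endo (f : {ffun 'I_n -> A}) : AG_endo sigma (auslander sigma f).
Proof.
split=> [x y|x c sc]; rewrite /auslander.
  by rewrite -big_split /=; apply: eq_bigr => i _; rewrite iter_lrD mulrDr.
rewrite mulr_suml; apply: eq_bigr => i _.
rewrite iter_lrM (@iter_weight _ _ _ _ 1 c) ?scale1r //.
by rewrite expr1n scale1r mulrA.
Qed.

Lemma auslanderD (f h : {ffun 'I_n -> A}) (b : A) :
  auslander sigma (f + h) b = auslander sigma f b + auslander sigma h b.
Proof.
by rewrite /auslander -big_split /=; apply: eq_bigr => i _; rewrite ffunE mulrDl.
Qed.

Lemma auslanderM (f h : {ffun 'I_n -> A}) (b : A) :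
  auslander sigma (skew_mul sigma f h) b = auslander sigma f (auslander sigma h b).
Proof.
have n0 := prim_order_gt0 w_prim.
rewrite /auslander.
transitivity (\sum_(l < n) \sum_(i < n) \sum_(j < n | ((i + j) %% n)%N == l)
    f i * iter i sigma (h j * iter j sigma b)).
  apply: eq_bigr => l _; rewrite ffunE mulr_suml; apply: eq_bigr => i _.
  rewrite mulr_suml; apply: eq_bigr => j /eqP <-.
  by rewrite iter_sigma_mod iterD iter_lrM mulrA.
rewrite exchange_big /=; apply: eq_bigr => i _.
rewrite iter_lr_sum mulr_sumr (exchange_big_dep xpredT) //=.
by apply: eq_bigr => j _; rewrite (big_pred1 (Ordinal (ltn_pmod (i + j) n0))).
Qed.

Lemma auslander1 (b : A) : auslander sigma (skew_one A n) b = b.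
Proof.
have n0 := prim_order_gt0 w_prim.
rewrite /auslander (bigD1 (Ordinal n0)) //= ffunE eqxx mul1r big1 ?addr0 // => i.
by rewrite ffunE -val_eqE /= => /negbTE->; rewrite mul0r.
Qed.

Lemma auslander_surj_of_weights (h : A -> A) :
    (forall x y, h (x + y) = h x + h y) ->
    (forall s : 'I_n, exists F : A, forall b, sigma b = w ^+ s *: b -> h b = F * b) ->
  exists f : {ffun 'I_n -> A}, auslander sigma f =1 h.
Proof.
move=> hD /fin_all_exists [F hF].
have h0 : h 0 = 0 by apply: (@addrI _ (h 0)); rewrite -hD !addr0.
(* This is $\sum_s F_s e_s$: each $e_s$ projects to weight [s], where [h] is left multiplication by
   [F s]. *)
exists [ffun i : 'I_n => \sum_(s < n) (n%:R^-1 / w ^+ (i * s)) *: F s] => b.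
rewrite -[in RHS](sum_weight_proj b) (big_morph h hD h0).
rewrite (eq_bigr _ (fun s _ => hF s _ (weight_proj_weight s b))) /auslander.
rewrite (eq_bigr (fun i : 'I_n => \sum_(s < n)
   (n%:R^-1 / w ^+ (i * s)) *: (F s * iter i sigma b))) => [|i _]; last first.
  by rewrite ffunE mulr_suml; apply: eq_bigr => s _; rewrite scalerAl.
rewrite exchange_big; apply: eq_bigr => s _ /=.
rewrite /weight_proj -scalerAr mulr_sumr scaler_sumr; apply: eq_bigr => i _.
by rewrite -scalerAr scalerA.
Qed.

End WeightDecomposition.

(** * Regularity modulo a regular normal element *)

Section NormalElement.

Variables (k : fieldType) (A : algType k) (u : A).
Hypotheses (u_lreg : GRing.lreg u) (u_rreg : GRing.rreg u).
Hypothesis norm_r : forall b, exists c, b * u = u * c.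
Hypothesis norm_l : forall b, exists c, u * b = c * u.

Lemma normalX (m : nat) (b : A) : exists c, b * u ^+ m = u ^+ m * c.
Proof.
elim: m b => [|m IH] b; first by exists b; rewrite mulr1 mul1r.
have [c bc] := norm_r b; have [d cd] := IH c.
by exists d; rewrite exprS mulrA bc -!mulrA cd.
Qed.

(** Injectivity of right multiplication by [y] on $A/Au$, phrased without forming the quotient. *)
Definition regular_mod_u (y : A) : Prop :=
  forall p c, p * y = c * u -> exists d, p = d * u.

Lemma regular_mod_uX (y : A) (m : nat) : regular_mod_u y -> regular_mod_u (y ^+ m).
Proof.
move=> yP; elim: m => [|m IH] p c; first by rewrite mulr1 => ->; exists c.
by rewrite exprSr mulrA => /yP[d]; apply: IH.
Qed.

(** Here $z = uyu^{-1}$ formally. Conjugation by [u] is an automorphism preserving $Au$, so it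
    preserves regularity modulo [u]. *)
Lemma regular_mod_u_twist (y z : A) :
  u * y = z * u -> regular_mod_u y -> regular_mod_u z.
Proof.
move=> yz yP p c pz.
have [p0 pE] := norm_r p; have [c0 cE] := norm_r c.
have [|d dE] := yP p0 c0.
  by apply: u_lreg; rewrite mulrA -pE -mulrA yz mulrA pz -mulrA [RHS]mulrA -cE mulrA.
have [e eE] := norm_l d; exists e; rewrite -eE.
by apply: u_rreg; rewrite pE dE mulrA.
Qed.

(** The inverse conjugation, carried out [s] times, one factor [u] at a time. *)
Lemma regular_mod_u_untwist (s : nat) (y z : A) :
  u ^+ s * y = z * u ^+ s -> regular_mod_u z -> regular_mod_u y.
Proof.
elim: s y => [|s IH] y; first by rewrite mul1r mulr1 => ->.
have [y1 y1E] := norm_l y.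
rewrite exprSr -mulrA y1E !mulrA => /u_rreg /IH y1P /y1P {}y1P p c py.
have [p1 p1E] := norm_l p; have [c1 c1E] := norm_l c.
have [|d dE] := y1P p1 c1.
  by apply: u_rreg; rewrite -mulrA -y1E mulrA -p1E -mulrA py mulrA c1E.
have [e eE] := norm_r d; exists e.
by apply: u_lreg; rewrite p1E dE mulrA eE.
Qed.

(** Each step splits one [u] off [p] on the right; moving it past [y] replaces [y] by its conjugate,
    which is still regular, and lowers [j]. *)
Lemma regular_mod_uP (j : nat) (y p c : A) :
  regular_mod_u y -> p * y = c * u ^+ j -> exists d, p = d * u ^+ j.
Proof.
elim: j y p c => [|j IH] y p c yP; first by exists p; rewrite mulr1.
rewrite exprSr mulrA => py; have [d dE] := yP _ _ py.
have [z yz] := norm_l y.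
have [|e eE] := IH z d c (regular_mod_u_twist yz yP).
  by apply: u_rreg; rewrite -py dE -!mulrA yz.
by exists e; rewrite mulrA -eE.
Qed.

End NormalElement.

(** * Algebras spanned by ordered monomials *)

Section SpannedByMonomials.

Variables (k : fieldType) (A : algType k) (u v : A).

(** Spanning is encoded as an induction principle, the form in which it is applied. *)
Definition spanned_by_monomials : Prop :=
  forall P : A -> Prop, P 0 -> (forall x y, P x -> P y -> P (x + y)) ->
    (forall c i j, P (c *: (u ^+ i * v ^+ j))) -> forall b, P b.

Hypothesis monomials_span : spanned_by_monomials.

Lemma normal_r_of_span (v' : A) :
  v * u = u * v' -> forall b, exists c, b * u = u * c.
Proof.
move=> vuE; have vX j : v ^+ j * u = u * v' ^+ j.
  by elim: j => [|j IH]; rewrite ?mulr1 ?mul1r // !exprS -mulrA IH !mulrA vuE.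
apply: monomials_span => [|x y [c xE] [d yE]|c i j].
- by exists 0; rewrite mul0r mulr0.
- by exists (c + d); rewrite mulrDl mulrDr xE yE.
exists (c *: (u ^+ i * v' ^+ j)).
by rewrite -scalerAl -scalerAr -mulrA vX !mulrA -exprSr -exprS.
Qed.

Lemma normal_l_of_span (v' : A) :
  u * v = v' * u -> forall b, exists c, u * b = c * u.
Proof.
move=> uvE; have vX j : u * v ^+ j = v' ^+ j * u.
  by elim: j => [|j IH]; rewrite ?mulr1 ?mul1r // !exprSr mulrA IH -!mulrA uvE.
apply: monomials_span => [|x y [c xE] [d yE]|c i j].
- by exists 0; rewrite mul0r mulr0.
- by exists (c + d); rewrite mulrDl mulrDr xE yE.
exists (c *: (u ^+ i * v' ^+ j)).
by rewrite -scalerAl -scalerAr -mulrA -vX !mulrA -exprSr -exprS.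
Qed.

End SpannedByMonomials.

(** * The Auslander map for a diagonal action *)

Section Auslander.

Variables (k : fieldType) (A : algType k) (u v : A) (n : nat) (w : k) (a : nat).
Variable sigma : {lrmorphism A -> A}.
Hypotheses (w_prim : n.-primitive_root w) (a_coprime : coprime a n).
Hypotheses (sigma_u : sigma u = w *: u) (sigma_v : sigma v = w ^+ a *: v).
Hypothesis u_lreg : GRing.lreg u.
Hypothesis u_rreg : GRing.rreg u.
Hypothesis norm_r : forall b, exists c, b * u = u * c.
Hypothesis norm_l : forall b, exists c, u * b = c * u.
Hypothesis v_regular : regular_mod_u u v.
Hypothesis monomials_span : spanned_by_monomials u v.

Lemma weight_monomial (i j : nat) :
  sigma (u ^+ i * v ^+ j) = w ^+ (i + a * j) *: (u ^+ i * v ^+ j).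
Proof.
rewrite rmorphM !rmorphXn /= sigma_u sigma_v !exprZn -scalerAl -scalerAr scalerA.
by rewrite exprD exprM.
Qed.

(** Monomials are eigenvectors whose eigenvalues are powers of [w], and they span. *)
Lemma sigma_order (b : A) : iter n sigma b = b.
Proof.
apply: (monomials_span (P := fun b => iter n sigma b = b)) => [|x y xE yE|c i j].
- exact: iter_lr0.
- by rewrite iter_lrD xE yE.
rewrite iter_lrZ (iter_weight _ (weight_monomial i j)).
by rewrite -exprM mulnC exprM (prim_expr_order w_prim) expr1n scale1r.
Qed.

Lemma sigma_uX (s : nat) : sigma (u ^+ s) = w ^+ s *: u ^+ s.
Proof. by rewrite rmorphXn /= sigma_u exprZn. Qed.

(** The factor [c] need not be invariant, but [c * u ^+ (n - s)] is. Applying [h] to $bu^n =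
    u^s(cu^{n-s})$ in two ways and cancelling $u^{n-s}$ gives the formula. *)
Lemma AG_endo_weight (h : A -> A) (s : nat) (b : A) :
    AG_endo sigma h -> (s < n)%N -> sigma b = w ^+ s *: b ->
  exists2 c, b * u ^+ s = u ^+ s * c & h b * u ^+ s = h (u ^+ s) * c.
Proof.
move=> [_ hM] ltsn sb; have [c bc] := normalX norm_r s b; exists c => //.
have uX (x : A) : x * u ^+ n = x * u ^+ s * u ^+ (n - s).
  by rewrite -mulrA -exprD subnKC // ltnW.
have un_fix : sigma (u ^+ n) = u ^+ n.
  by rewrite sigma_uX (prim_expr_order w_prim) scale1r.
(* Its product with [u ^+ s] is [b * u ^+ n]; this and [u ^+ s] both have weight [s], so the
   quotient has weight 0. *)
have c_fix : sigma (c * u ^+ (n - s)) = c * u ^+ (n - s).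
  apply: (lregX (n := s) u_lreg); apply: (scalerI (expf_neq0 s (prim_root_neq0 w_prim))).
  have ucE : u ^+ s * (c * u ^+ (n - s)) = b * u ^+ n by rewrite uX bc mulrA.
  by rewrite scalerAl -sigma_uX -rmorphM ucE rmorphM /= un_fix sb scalerAl.
apply: (rregX (n := n - s) u_rreg); rewrite -uX -hM // uX bc -mulrA hM //.
by rewrite mulrA.
Qed.

Lemma AG_endo_weight_mul (h : A -> A) (s : 'I_n) :
  AG_endo sigma h -> exists F, forall b, sigma b = w ^+ s *: b -> h b = F * b.
Proof.
move=> hP; have [m _ wm] := exp_coprime_surj w_prim s a_coprime.
have vm : sigma (v ^+ m) = w ^+ s *: v ^+ m.
  by rewrite rmorphXn /= sigma_v exprZn -exprM wm.
have [y yE hvE] := AG_endo_weight hP (ltn_ord s) vm.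
(* [y] is the conjugate of [v ^+ m] by [u ^+ s], and powers of [v] are regular modulo [u]. *)
have yP : regular_mod_u u y.
  exact: (regular_mod_u_untwist u_lreg u_rreg norm_r norm_l (esym yE)
            (regular_mod_uX (m := m) v_regular)).
have [F FE] := regular_mod_uP u_lreg u_rreg norm_r norm_l yP (esym hvE).
exists F => b /(AG_endo_weight hP (ltn_ord s))[c bc hbc].
by apply: (rregX (n := s) u_rreg); rewrite hbc FE -!mulrA bc.
Qed.

Lemma auslander_inj (f h : {ffun 'I_n -> A}) :
  auslander sigma f =1 auslander sigma h -> f = h.
Proof.
move=> eq_fh.
(* The value at [u ^+ s] is the [s]-th Fourier coefficient of [g] times [u ^+ s], which can be
   cancelled. *)
have ausE (g : {ffun 'I_n -> A}) (s : nat) :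
    auslander sigma g (u ^+ s) = (\sum_(i < n) w ^+ (s * i) *: g i) * u ^+ s.
  rewrite /auslander mulr_suml; apply: eq_bigr => i _.
  by rewrite (iter_weight _ (sigma_uX s)) -exprM -scalerAr scalerAl.
apply/ffunP => j; apply: (scalerI (prim_root_natf_neq0 w_prim)).
rewrite -!(dft_inv w_prim); apply: eq_bigr => s _; congr (_ *: _).
by apply: (rregX (n := s) u_rreg); rewrite -!ausE.
Qed.

Lemma auslander_is_iso : auslander_iso n sigma.
Proof.
split; first exact: auslander_AG_endo.
split; first exact: auslanderD.
split; first exact: (auslanderM w_prim sigma_order).
split; first exact: (auslander1 w_prim).
split; first exact: auslander_inj.
move=> h hP; apply: (auslander_surj_of_weights w_prim sigma_order); first exact: hP.1.
by move=> s; apply: AG_endo_weight_mul.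
Qed.

(** * The ideal of [gbar] and its finite-dimensional quotient *)

Definition pure (c : A) (i : 'I_n) : {ffun 'I_n -> A} :=
  [ffun j => if j == i then c else 0].

Lemma pureD (i : 'I_n) : {morph pure^~ i : x y / x + y}.
Proof. by move=> x y; apply/ffunP => j; rewrite !ffunE; case: ifP; rewrite ?addr0. Qed.

Lemma pure_scale (c : k) (b : A) (i : 'I_n) : pure (c *: b) i = c *: pure b i.
Proof. by apply/ffunP => j; rewrite !ffunE; case: ifP; rewrite ?scaler0. Qed.

Lemma sum_pure (z : {ffun 'I_n -> A}) : z = \sum_i pure (z i) i.
Proof.
apply/ffunP => j; rewrite sum_ffunE (bigD1 j) //= ffunE eqxx big1 ?addr0 // => i.
by rewrite ffunE eq_sym => /negbTE->.
Qed.

Lemma in_gbar_ideal0 : in_gbar_ideal sigma (0 : {ffun 'I_n -> A}).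
Proof. by exists [::]; rewrite big_nil. Qed.

Lemma in_gbar_idealD (y z : {ffun 'I_n -> A}) :
  in_gbar_ideal sigma y -> in_gbar_ideal sigma z -> in_gbar_ideal sigma (y + z).
Proof. by move=> [s ->] [t ->]; exists (s ++ t); rewrite big_cat. Qed.

(** This function represents $b\,\overline g\,c$, because $g^l c = \sigma^l(c) g^l$. *)
Lemma in_gbar_ideal_orbit (b c : A) :
  in_gbar_ideal sigma [ffun l : 'I_n => b * iter l sigma c].
Proof.
have n0 := prim_order_gt0 w_prim.
exists [:: (pure b (Ordinal n0), pure c (Ordinal n0))]; rewrite big_seq1 /=.
have -> : skew_mul sigma (pure b (Ordinal n0)) (gbar A n) = [ffun _ => b].
  apply/ffunP => l; rewrite !ffunE (bigD1 (Ordinal n0)) //= [X in _ + X]big1.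
    rewrite addr0 (big_pred1 l) => [|j]; first by rewrite !ffunE eqxx mulr1.
    by rewrite /= add0n modn_small // val_eqE.
  by move=> i /negbTE i0; apply: big1 => j _; rewrite ffunE i0 mul0r.
apply/ffunP => l; rewrite !ffunE (exchange_big_dep xpredT) //=.
rewrite (bigD1 (Ordinal n0)) //= [X in _ + X]big1 => [|j /negbTE j0].
  rewrite addr0 (big_pred1 l) => [|i]; first by rewrite !ffunE eqxx.
  by rewrite /= addn0 modn_small // val_eqE.
by apply: big1 => i _; rewrite !ffunE j0 iter_lr0 mulr0.
Qed.

(* A right factor of weight s moves gbar to the idempotent of the character s;
   all the characters together recover the group elements by Fourier inversion. *)
Lemma in_gbar_ideal_pure (x : A) (i : 'I_n) :
    (forall s : 'I_n, exists b c, x = b * c /\ sigma c = w ^+ s *: c) ->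
  in_gbar_ideal sigma (pure x i).
Proof.
move=> xP.
have -> : pure x i = \sum_(s < n)
    [ffun l : 'I_n => (n%:R^-1 / w ^+ (s * i)) *: (w ^+ (s * l) *: x)].
  apply/ffunP => j; rewrite sum_ffunE !ffunE.
  rewrite (eq_bigr (fun s : 'I_n =>
      n%:R^-1 *: ((w ^+ (s * j) / w ^+ (s * i)) *: x))) => [|s _]; last first.
    by rewrite ffunE !scalerA mulrAC mulrA.
  rewrite -scaler_sumr -scaler_suml (sum_prim_root w_prim) scalerA.
  case: eqP => _; last by rewrite mulr0 scale0r.
  by rewrite mulVf ?scale1r // (prim_root_natf_neq0 w_prim).
apply: (big_ind (in_gbar_ideal sigma)) => [||s _].
- exact: in_gbar_ideal0.
- exact: in_gbar_idealD.
have [b [c [-> sc]]] := xP s.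
have := in_gbar_ideal_orbit ((n%:R^-1 / w ^+ (s * i)) *: b) c.
congr in_gbar_ideal; apply/ffunP => l; rewrite !ffunE (iter_weight _ sc) -exprM.
by rewrite -scalerAl -!scalerAr.
Qed.

Lemma in_gbar_ideal_monomial (e : k) (i j : nat) (l : 'I_n) :
  (n <= i)%N || (n <= j)%N -> in_gbar_ideal sigma (pure (e *: (u ^+ i * v ^+ j)) l).
Proof.
move=> large; apply: in_gbar_ideal_pure => s.
case/orP: large => [le_ni|le_nj]; last first.
  (* For [j >= n], the right factor of weight [s] is a power of [v] alone. *)
  have [m ltmn wm] := exp_coprime_surj w_prim s a_coprime.
  exists (e *: (u ^+ i * v ^+ (j - m))), (v ^+ m).
  rewrite -scalerAl -mulrA -exprD subnK ?(leq_trans (ltnW ltmn)) //; split=> //.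
  by have := weight_monomial 0 m; rewrite mul1r wm.
(* The exponent represents $s - aj$ modulo [n]; the added multiple of [n] prevents truncation. Then
   [u ^+ m * v ^+ j] has weight [s]. *)
have [m ltmn wm] := exp_coprime_surj w_prim (s + n * (a * j) - a * j) (coprime1n n).
exists (e *: u ^+ (i - m)), (u ^+ m * v ^+ j).
rewrite -scalerAl mulrA -exprD subnK ?(leq_trans (ltnW ltmn)) //; split=> //.
rewrite weight_monomial exprD -[m]mul1n wm -exprD subnK; last first.
  by rewrite (leq_trans _ (leq_addl _ _)) // leq_pmull // (prim_order_gt0 w_prim).
by rewrite exprD exprM (prim_expr_order w_prim) expr1n mulr1.
Qed.

Lemma quotient_is_fin_dim : quotient_fin_dim n sigma.
Proof.
pose mono (x : 'I_n * 'I_n * 'I_n) := pure (u ^+ x.1.1 * v ^+ x.1.2) x.2.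
pose s := [seq mono x | x <- enum {: 'I_n * 'I_n * 'I_n}].
exists s.
pose fd z := exists c : 'I_(size s) -> k,
  in_gbar_ideal sigma (z - \sum_(i < size s) c i *: s`_i).
have fdI z : in_gbar_ideal sigma z -> fd z.
  move=> zI; exists (fun=> 0); rewrite big1 ?subr0 // => i _.
  by rewrite scale0r.
have fdD y z : fd y -> fd z -> fd (y + z).
  move=> [c yI] [d zI]; exists (fun i => c i + d i).
  have := in_gbar_idealD yI zI; congr in_gbar_ideal.
  under [in RHS]eq_bigr do rewrite scalerDl.
  by rewrite big_split opprD addrACA.
have fd0 : fd 0 := fdI _ in_gbar_ideal0.
move=> z; rewrite -/(fd z) [z]sum_pure; apply: big_ind => // l _.
apply: (monomials_span (P := fun b => fd (pure b l))) => [|x y xP yP|c i j].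
- by have -> : pure 0 l = 0 by apply/ffunP => j; rewrite !ffunE if_same.
- by rewrite pureD; apply: fdD.
have [le_ni|lt_in] := leqP n i.
  by apply/fdI/in_gbar_ideal_monomial; rewrite le_ni.
have [le_nj|lt_jn] := leqP n j.
  by apply/fdI/in_gbar_ideal_monomial; rewrite le_nj orbT.
have : mono (Ordinal lt_in, Ordinal lt_jn, l) \in s by rewrite map_f ?mem_enum.
(* A monomial with both exponents below [n] is itself in the list, so one coefficient suffices. *)
case/(nthP 0) => x ltxs xE; exists (fun y => if y == Ordinal ltxs then c else 0).
rewrite (bigD1 (Ordinal ltxs)) //= eqxx big1 => [|y /negbTE->]; last by rewrite scale0r.
by rewrite xE pure_scale addr0 subrr; apply: in_gbar_ideal0.
Qed.

End Auslander.

(** * Ore extensions of k[u] *)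

Section OreExtension.

Variable k : fieldType.

(* Data for the Ore extension k[u][v; s, d], in which v r = s(r) v + d(r). *)
Record ore_data := OreData {
  ore_s : {lrmorphism {poly k} -> {poly k}};
  ore_d : {linear {poly k} -> {poly k}};
  ore_leibniz : forall r t, ore_d (r * t) = ore_s r * ore_d t + ore_d r * t
}.

(** An alias indexed by the data, so that the twisted product becomes its ring structure while
    bivariate polynomials keep the commutative one. *)
Definition ore of ore_data : Type := {poly {poly k}}.

Variable D : ore_data.
Local Notation s := (ore_s D).
Local Notation d := (ore_d D).
Implicit Types p q t : {poly {poly k}}.

(* A polynomial [\sum_i p`_i 'X^i] over k[u] stands for [\sum_i p`_i v^i];
   [ore_shift] is left multiplication by v. *)
Definition ore_shift p : {poly {poly k}} := map_poly s p * 'X + map_poly d p.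

Definition ore_mul p q : {poly {poly k}} :=
  \sum_(i < size p) p`_i *: iter i ore_shift q.

Lemma ore_d1 : d 1 = 0.
Proof.
apply: (@addrI _ (d 1)); rewrite addr0.
by have := ore_leibniz D 1 1; rewrite rmorph1 !mul1r mulr1 => <-.
Qed.

Lemma coef_ore_shift p i :
  (ore_shift p)`_i = (if i is j.+1 then s p`_j else 0) + d p`_i.
Proof.
by rewrite coefD coefMX !coef_map_id0 ?rmorph0 ?linear0 //; case: i => //= i; rewrite coef_map.
Qed.

Lemma ore_shiftD : {morph ore_shift : p q / p + q}.
Proof.
move=> p q; apply/polyP => -[|i]; rewrite coefD !coef_ore_shift !coefD !raddfD ?add0r //=.
by rewrite addrACA.
Qed.

Lemma ore_shiftZ (r : {poly k}) p :
  ore_shift (r *: p) = s r *: ore_shift p + d r *: p.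
Proof.
apply/polyP => -[|i]; rewrite [RHS]coefD !coefZ !coef_ore_shift !coefZ ore_leibniz ?add0r //.
by rewrite rmorphM mulrDr addrA.
Qed.

Lemma ore_shift0 : ore_shift 0 = 0.
Proof. by apply: (@addrI _ (ore_shift 0)); rewrite -ore_shiftD !addr0. Qed.

Lemma ore_shiftXn i : ore_shift 'X^i = 'X^(i.+1).
Proof.
apply/polyP => -[|j]; rewrite coef_ore_shift !coefXn ?eqSS.
  by case: eqP => _; rewrite ?ore_d1 ?linear0 addr0.
by do 2!case: eqP => _; rewrite ?rmorph1 ?rmorph0 ?ore_d1 ?linear0 ?addr0.
Qed.

Lemma iter_ore_shiftXn i j : iter i ore_shift 'X^j = 'X^(i + j).
Proof. by elim: i => //= i ->; rewrite ore_shiftXn. Qed.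

Lemma iter_ore_shiftD i : {morph iter i ore_shift : p q / p + q}.
Proof. by elim: i => // i IH p q; rewrite !iterS IH ore_shiftD. Qed.

Lemma ore_s_polyC (c : k) : s c%:P = c%:P.
Proof. by rewrite -[c%:P]mulr1 mul_polyC linearZ /= rmorph1. Qed.

Lemma ore_d_polyC (c : k) : d c%:P = 0.
Proof. by rewrite -[c%:P]mulr1 mul_polyC linearZ /= ore_d1 scaler0. Qed.

Lemma iter_ore_shiftZ i (c : k) p :
  iter i ore_shift (c%:P *: p) = c%:P *: iter i ore_shift p.
Proof.
by elim: i => //= i ->; rewrite ore_shiftZ ore_s_polyC ore_d_polyC scale0r addr0.
Qed.

Lemma ore_mul_widen m p q : (size p <= m)%N ->
  ore_mul p q = \sum_(i < m) p`_i *: iter i ore_shift q.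
Proof.
move=> le_pm; rewrite /ore_mul (big_ord_widen m (fun i => p`_i *: iter i ore_shift q) le_pm).
rewrite [RHS](bigID (fun i : 'I_m => (i < size p)%N)) /= [X in _ = _ + X]big1 ?addr0 // => i.
by rewrite -leqNgt => /(nth_default 0)->; rewrite scale0r.
Qed.

Lemma ore_mulDl : left_distributive ore_mul +%R.
Proof.
move=> p q t; pose m := maxn (size p) (size q).
rewrite !(@ore_mul_widen m) ?leq_maxl ?leq_maxr ?size_polyD //.
by rewrite -big_split; apply: eq_bigr => i _ /=; rewrite coefD scalerDl.
Qed.

Lemma ore_mulDr : right_distributive ore_mul +%R.
Proof.
move=> p q t; rewrite -big_split; apply: eq_bigr => i _ /=.
by rewrite iter_ore_shiftD scalerDr.
Qed.

Lemma ore_mulZl (r : {poly k}) p q : ore_mul (r *: p) q = r *: ore_mul p q.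
Proof.
rewrite (ore_mul_widen _ (size_scale_leq r p)) scaler_sumr.
by apply: eq_bigr => i _; rewrite coefZ scalerA.
Qed.

Lemma ore_mulZr (c : k) p q : ore_mul p (c%:P *: q) = c%:P *: ore_mul p q.
Proof.
rewrite scaler_sumr; apply: eq_bigr => i _.
by rewrite iter_ore_shiftZ !scalerA mulrC.
Qed.

Lemma ore_mul0l q : ore_mul 0 q = 0.
Proof. by rewrite /ore_mul size_poly0 big_ord0. Qed.

Lemma ore_mul1l : left_id 1 ore_mul.
Proof. by move=> p; rewrite /ore_mul size_poly1 big_ord1 coef1 scale1r. Qed.

Lemma ore_mulXn p j : ore_mul p 'X^j = p * 'X^j.
Proof.
rewrite /ore_mul -[in RHS](coefK p) poly_def mulr_suml; apply: eq_bigr => i _.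
by rewrite iter_ore_shiftXn exprD scalerAl.
Qed.

Lemma ore_mul1r : right_id 1 ore_mul.
Proof. by move=> p; have := ore_mulXn p 0; rewrite expr0 mulr1. Qed.

(** Associativity $(vp)q = v(pq)$, the case to which the general one reduces. *)
Lemma ore_mul_shiftl p q : ore_mul (ore_shift p) q = ore_shift (ore_mul p q).
Proof.
have le_sh : (size (ore_shift p) <= (size p).+1)%N.
  apply/leq_sizeP => -[|i] //; rewrite ltnS => le_i; rewrite coef_ore_shift.
  by rewrite !nth_default ?rmorph0 ?linear0 ?addr0 // ltnW.
rewrite (ore_mul_widen _ le_sh) [in RHS]/ore_mul.
rewrite (big_morph _ ore_shiftD ore_shift0).
under [RHS]eq_bigr do rewrite ore_shiftZ.
under [LHS]eq_bigr do rewrite coef_ore_shift scalerDl.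
(* The [s]-part starts in degree 1, while the [d]-part has no term in degree [size p]. *)
rewrite !big_split /= big_ord_recl /= scale0r add0r; congr (_ + _).
by rewrite big_ord_recr /= nth_default // linear0 scale0r addr0.
Qed.

Lemma ore_mulA : associative ore_mul.
Proof.
move=> p q t; rewrite [ore_mul p q]/ore_mul.
rewrite (big_morph (ore_mul^~ t) (fun x y => ore_mulDl x y t) (ore_mul0l t)).
apply: eq_bigr => i _; rewrite ore_mulZl; congr (_ *: _).
by elim: (i : nat) => //= j ->; rewrite ore_mul_shiftl.
Qed.

HB.instance Definition _ := GRing.Zmodule.on (ore D).

Lemma ore_1neq0 : (1 : {poly {poly k}}) != 0.
Proof. exact: oner_neq0. Qed.

HB.instance Definition _ := GRing.Zmodule_isNzRing.Build (ore D)
  ore_mulA ore_mul1l ore_mul1r ore_mulDl ore_mulDr ore_1neq0.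

Definition ore_scale (c : k) (p : ore D) : ore D := c%:P *: (p : {poly {poly k}}).

Lemma ore_scaleA b c p : ore_scale b (ore_scale c p) = ore_scale (b * c) p.
Proof. by rewrite /ore_scale scalerA polyCM. Qed.

Lemma ore_scale1 : left_id 1 ore_scale.
Proof. by move=> p; rewrite /ore_scale scale1r. Qed.

Lemma ore_scaleDr : right_distributive ore_scale +%R.
Proof. by move=> c p q; rewrite /ore_scale scalerDr. Qed.

Lemma ore_scaleDl p : {morph ore_scale^~ p : b c / b + c}.
Proof. by move=> b c; rewrite /ore_scale polyCD scalerDl. Qed.

HB.instance Definition _ := GRing.Zmodule_isLmodule.Build k (ore D)
  ore_scaleA ore_scale1 ore_scaleDr ore_scaleDl.

Lemma ore_scaleAl (c : k) (p q : ore D) : c *: (p * q) = (c *: p) * q.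
Proof. exact: (esym (ore_mulZl _ _ _)). Qed.

HB.instance Definition _ := GRing.Lmodule_isLalgebra.Build k (ore D) ore_scaleAl.

Lemma ore_scaleAr (c : k) (p q : ore D) : c *: (p * q) = p * (c *: q).
Proof. exact: (esym (ore_mulZr _ _ _)). Qed.

HB.instance Definition _ := GRing.Lalgebra_isAlgebra.Build k (ore D) ore_scaleAr.

Definition ore_u : ore D := ('X : {poly k})%:P.
Definition ore_v : ore D := 'X.

Lemma ore_mul_uE (p : ore D) : ore_u * p = 'X *: (p : {poly {poly k}}) :> {poly {poly k}}.
Proof.
rewrite -[LHS]/(ore_mul ('X)%:P p) -alg_polyC ore_mulZl; congr (_ *: _).
exact: ore_mul1l.
Qed.

Lemma ore_mul_vE (p : ore D) : p * ore_v = (p : {poly {poly k}}) * 'X :> {poly {poly k}}.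
Proof. exact: (ore_mulXn p 1). Qed.

Lemma ore_v_mulE (p : ore D) : ore_v * p = ore_shift p.
Proof.
rewrite -[LHS]/(ore_mul 'X p) /ore_mul size_polyX !big_ord_recl big_ord0 /=.
by rewrite !coefX /= scale0r add0r scale1r addr0.
Qed.

Lemma ore_vuE (r : {poly k}) :
  ore_v * (r%:P : ore D) = (s r *: 'X + (d r)%:P : {poly {poly k}}).
Proof.
by rewrite ore_v_mulE /ore_shift !map_polyC ?rmorph0 ?linear0 // mul_polyC.
Qed.

Lemma ore_u_lreg : GRing.lreg ore_u.
Proof.
move=> p q pq; have : 'X *: (p : {poly {poly k}}) = 'X *: (q : {poly {poly k}}).
  by rewrite -!ore_mul_uE pq.
by rewrite -!mul_polyC; apply: mulfI; rewrite polyC_eq0 polyX_eq0.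
Qed.

(** That is, $v^i r = s^i(r) v^i$ plus terms of lower degree in [v]. *)
Lemma coef_iter_ore_shiftC i j (r : {poly k}) : (i <= j)%N ->
  (iter i ore_shift r%:P)`_j = if i == j then iter i s r else 0.
Proof.
elim: i j => [|i IH] [|j] // le_ij; rewrite ?coefC //.
rewrite iterS coef_ore_shift !IH // 1?ltnW // eqSS.
rewrite (ltn_eqF le_ij) linear0 addr0.
by case: eqP => // _; rewrite rmorph0.
Qed.

(* The leading coefficient in v of [p * u] is that of [p] times [s^deg(p) u]. *)
Lemma ore_u_rreg0 (q : k) (p : ore D) : q != 0 -> s 'X = q *: 'X -> p * ore_u = 0 -> p = 0.
Proof.
move=> q0 sX; rewrite -[_ * _]/(ore_mul p ('X)%:P) => pu0; apply/eqP/contraT => p0.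
have sXi i : iter i s 'X = q ^+ i *: 'X by rewrite (iter_weight _ sX).
move: pu0; rewrite /ore_mul.
have: size (p : {poly {poly k}}) != 0%N by rewrite size_poly_eq0.
case E: (size _) => [//|m] _ /(congr1 (fun t : {poly {poly k}} => t`_m)).
rewrite coef0 coef_sum big_ord_recr /= coefZ coef_iter_ore_shiftC // eqxx big1 => [|i _].
  move/eqP; rewrite add0r mulf_eq0 sXi scaler_eq0 expf_eq0 (negbTE q0) andbF polyX_eq0 !orbF.
  have -> : m = (size (p : {poly {poly k}})).-1 by rewrite E.
  by rewrite -lead_coefE lead_coef_eq0 (negbTE p0).
by rewrite coefZ coef_iter_ore_shiftC ?(ltnW (ltn_ord i)) // ltn_eqF ?mulr0.
Qed.

End OreExtension.

(** * Evaluation of an Ore extension in an algebra *)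

Lemma horner_alg_coef (k : fieldType) (A : algType k) (u : A) (r : {poly k}) :
  horner_alg u r = \sum_(j < size r) r`_j *: u ^+ j.
Proof.
have coefE (j : nat) : (map_poly (in_alg A) r)`_j * u ^+ j = r`_j *: u ^+ j.
  by rewrite coef_map /= -scalerAl mul1r.
rewrite -[LHS]/((map_poly (in_alg A) r).[u]) horner_coef size_map_poly.
by under eq_bigr do rewrite coefE.
Qed.

Section OreEvaluation.

Variables (k : fieldType) (D : ore_data k) (A : algType k) (u v : A).
Local Notation s := (ore_s D).
Local Notation d := (ore_d D).

Hypothesis vu : v * u = horner_alg u (s 'X) * v + horner_alg u (d 'X).

(** The rule for ['X] propagates to all of k[u], since the Leibniz rule makes it stable under
    products. *)
Lemma ore_commutation (r : {poly k}) :
  v * horner_alg u r = horner_alg u (s r) * v + horner_alg u (d r).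
Proof.
elim/poly_ind: r => [|r c IH]; first by rewrite !raddf0 mulr0 mul0r addr0.
have rE : v * (horner_alg u r * u) = horner_alg u (s (r * 'X)) * v + horner_alg u (d (r * 'X)).
  rewrite ore_leibniz rmorphD !rmorphM /= horner_algX mulrA IH mulrDl -!mulrA vu.
  by rewrite mulrDr addrA.
rewrite !rmorphD linearD rmorphM /= horner_algX ore_s_polyC ore_d_polyC rmorphD /=.
rewrite rmorph0 addr0 horner_algC mulrDr rE mulrDl.
by rewrite -scalerAr -scalerAl mulr1 mul1r addrAC.
Qed.

Definition ore_eval (p : ore D) : A :=
  \sum_(i < size (p : {poly {poly k}})) horner_alg u (p : {poly {poly k}})`_i * v ^+ i.

Lemma ore_eval_widen m (p : {poly {poly k}}) : (size p <= m)%N ->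
  ore_eval p = \sum_(i < m) horner_alg u p`_i * v ^+ i.
Proof.
move=> le_pm; rewrite /ore_eval (big_ord_widen m (fun i => horner_alg u p`_i * v ^+ i) le_pm).
rewrite [RHS](bigID (fun i : 'I_m => (i < size p)%N)) /= [X in _ = _ + X]big1 ?addr0 // => i.
by rewrite -leqNgt => /(nth_default 0)->; rewrite rmorph0 mul0r.
Qed.

Lemma ore_evalD : {morph ore_eval : p q / p + q}.
Proof.
move=> p q; pose m := maxn (size (p : {poly {poly k}})) (size (q : {poly {poly k}})).
rewrite !(@ore_eval_widen m) ?leq_maxl ?leq_maxr ?size_polyD //.
by rewrite -big_split; apply: eq_bigr => i _ /=; rewrite coefD rmorphD mulrDl.
Qed.

Lemma ore_eval0 : ore_eval 0 = 0.
Proof. by rewrite (@ore_eval_widen 0) ?big_ord0 // size_poly0. Qed.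

Lemma ore_evalZ (r : {poly k}) (p : {poly {poly k}}) :
  ore_eval (r *: p) = horner_alg u r * ore_eval p.
Proof.
rewrite (ore_eval_widen (size_scale_leq r p)) mulr_sumr.
by apply: eq_bigr => i _; rewrite coefZ rmorphM mulrA.
Qed.

Lemma ore_eval_shift (p : {poly {poly k}}) :
  ore_eval (ore_shift D p) = v * ore_eval p.
Proof.
have le_sh : (size (ore_shift D p) <= (size p).+1)%N.
  apply/leq_sizeP => -[|i] //; rewrite ltnS => le_i; rewrite coef_ore_shift.
  by rewrite !nth_default ?rmorph0 ?linear0 ?addr0 // ltnW.
rewrite (ore_eval_widen le_sh) mulr_sumr.
under [RHS]eq_bigr do rewrite mulrA ore_commutation mulrDl -mulrA -exprS.
under [LHS]eq_bigr do rewrite coef_ore_shift rmorphD mulrDl.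
rewrite !big_split /= big_ord_recl /= rmorph0 mul0r add0r; congr (_ + _).
by rewrite big_ord_recr /= nth_default // linear0 rmorph0 mul0r addr0.
Qed.

(** Multiplicativity reduces to compatibility with left multiplication by k[u] and by [v]. *)
Lemma ore_eval_monoid : monoid_morphism ore_eval.
Proof.
split=> [|p q].
  by rewrite (@ore_eval_widen 1) ?size_poly1 // big_ord1 coef1 rmorph1 mulr1.
rewrite -[p * q]/(ore_mul D p q) /ore_mul (big_morph _ ore_evalD ore_eval0) mulr_suml.
apply: eq_bigr => i _; rewrite ore_evalZ -mulrA; congr (_ * _).
by elim: (i : nat) => [|j IH]; rewrite ?mul1r // iterS ore_eval_shift IH exprS mulrA.
Qed.

Lemma ore_eval_scalable : scalable ore_eval.
Proof.
move=> c p; rewrite -[c *: p]/(c%:P *: (p : {poly {poly k}})) ore_evalZ.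
by rewrite horner_algC -scalerAl mul1r.
Qed.

Lemma ore_eval_zmod : zmod_morphism ore_eval.
Proof.
move=> p q; rewrite ore_evalD; congr (_ + _).
by rewrite -scaleN1r ore_eval_scalable scaleN1r.
Qed.

Lemma ore_eval_lrmorphism : exists g : {lrmorphism ore D -> A}, g =1 ore_eval.
Proof.
pose g : {lrmorphism ore D -> A} := HB.pack ore_eval
  (GRing.isZmodMorphism.Build _ _ ore_eval ore_eval_zmod)
  (GRing.isMonoidMorphism.Build _ _ ore_eval ore_eval_monoid)
  (GRing.isScalable.Build k _ _ _ ore_eval ore_eval_scalable).
by exists g.
Qed.

Lemma ore_eval_u : ore_eval (ore_u D) = u.
Proof.
rewrite (@ore_eval_widen 1) ?size_polyC_leq1 // big_ord1 coefC mulr1.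
exact: horner_algX.
Qed.

Lemma ore_eval_v : ore_eval (ore_v D) = v.
Proof.
rewrite (@ore_eval_widen 2) ?size_polyX // !big_ord_recl big_ord0 !coefX /=.
by rewrite rmorph0 rmorph1 mul0r mul1r add0r addr0.
Qed.

End OreEvaluation.

(** * Transfer from the Ore extension to the presented algebra *)

Section OrePresentation.

Variables (k : fieldType) (D : ore_data k) (A : algType k) (u v : A) (q : k).
Variable rel : forall B : algType k, B -> B -> Prop.
Hypothesis pres : presented_by rel u v.
Hypothesis rel_ore : rel (ore_u D) (ore_v D).
Hypothesis vu : v * u = horner_alg u (ore_s D 'X) * v + horner_alg u (ore_d D 'X).
Hypotheses (q0 : q != 0) (sX : ore_s D 'X = q *: 'X).

(** The universal property gives [f], evaluation gives [g]; [g \o f] fixes [u] and [v], hence is the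
    identity by uniqueness. So [f] embeds [A] in the concrete model. *)
Lemma ore_presentation : exists (f : {lrmorphism A -> ore D}) (g : {lrmorphism ore D -> A}),
  [/\ f u = ore_u D, f v = ore_v D, g =1 ore_eval u v & cancel f g].
Proof.
have [g gE] := ore_eval_lrmorphism vu.
have [_ univ] := pres.
have [[f [fu fv]] _] := univ _ _ _ rel_ore.
exists f, g; split=> // b.
have [_ uniq] := univ A u v pres.1.
apply: (uniq (g \o f : {lrmorphism A -> A}) (idfun : {lrmorphism A -> A})) => /=.
  by rewrite fu gE ore_eval_u.
by rewrite fv gE ore_eval_v.
Qed.

Lemma presented_span : spanned_by_monomials u v.
Proof.
have [f [g [_ _ gE fK]]] := ore_presentation.
move=> P P0 PD PM b; rewrite -(fK b) gE /ore_eval.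
apply: big_ind => // i _; move: (nth _ _ _) => r.
rewrite horner_alg_coef mulr_suml; apply: big_ind => // j _.
by rewrite -scalerAl.
Qed.

Lemma presented_lreg : GRing.lreg u.
Proof.
have [f [g [fu _ _ fK]]] := ore_presentation.
move=> x y xy; apply: (can_inj fK); apply: (@ore_u_lreg _ D).
by rewrite -fu -!rmorphM xy.
Qed.

Lemma presented_rreg : GRing.rreg u.
Proof.
have [f [g [fu _ _ fK]]] := ore_presentation.
move=> x y /eqP; rewrite -subr_eq0 -mulrBl => /eqP xy; apply/eqP.
rewrite -subr_eq0 -(fK (x - y)) (ore_u_rreg0 q0 sX (p := f (x - y))) ?rmorph0 //.
by rewrite -fu -rmorphM xy rmorph0.
Qed.

Lemma presented_v_regular :
  (forall b, exists c, b * u = u * c) -> (forall b, exists c, u * b = c * u) ->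
  regular_mod_u u v.
Proof.
move=> norm_r norm_l p c pv; have [c' cE] := norm_r c.
have [f [g [fu fv gE fK]]] := ore_presentation.
have fpE : f p * ore_v D = ore_u D * f c' by rewrite -fu -fv -!rmorphM pv cE.
(* Comparing coefficients of $v^{i+1}$ in $pv = uc'$ shows that each coefficient of [p] is ['X]
   times the next one of $c'$; so [t] is $c'$ lowered by one degree in [v]. *)
pose t : ore D := \poly_(i < size (f c' : {poly {poly k}})) (f c' : {poly {poly k}})`_i.+1.
have fpt : f p = ore_u D * t.
  rewrite ore_mul_uE; apply/polyP => i.
  have := congr1 (fun x : {poly {poly k}} => x`_i.+1) fpE.
  rewrite ore_mul_vE ore_mul_uE coefMX !coefZ coef_poly /= => ->.
  by case: ltnP => // le_i; rewrite nth_default // (leq_trans le_i).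
have [e eE] := norm_l (g t); exists e.
by rewrite -eE -(fK p) fpt rmorphM /= gE ore_eval_u.
Qed.

Lemma auslander_of_presented (n a : nat) (w : k) (sigma : {lrmorphism A -> A}) (v1 v2 : A) :
    n.-primitive_root w -> coprime a n ->
    sigma u = w *: u -> sigma v = w ^+ a *: v ->
    v * u = u * v1 -> u * v = v2 * u ->
  quotient_fin_dim n sigma /\ auslander_iso n sigma.
Proof.
move=> w_prim co su sv vuE uvE.
have norm_r := normal_r_of_span presented_span vuE.
have norm_l := normal_l_of_span presented_span uvE.
split; first exact: (quotient_is_fin_dim w_prim co su sv presented_span).
exact: (auslander_is_iso w_prim co su sv presented_lreg presented_rreg norm_r norm_l
          (presented_v_regular norm_r norm_l) presented_span).
Qed.

End OrePresentation.

(** * The quantum plane and the Jordan plane as Ore extensions *)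

Lemma qplane_leibniz (k : fieldType) (q : k) (r t : {poly k}) :
  (\0 : {linear {poly k} -> {poly k}}) (r * t)
    = comp_poly (q *: 'X) r * (\0 : {linear {poly k} -> {poly k}}) t
      + (\0 : {linear {poly k} -> {poly k}}) r * t.
Proof. by rewrite /= mulr0 mul0r addr0. Qed.

Definition qplane_data (k : fieldType) (q : k) : ore_data k :=
  OreData (qplane_leibniz q).

Lemma jplane_leibniz (k : fieldType) (r t : {poly k}) :
  ('X^2 \*o @deriv k) (r * t)
    = idfun r * ('X^2 \*o @deriv k) t + ('X^2 \*o @deriv k) r * t.
Proof.
rewrite /= derivM mulrDr addrC; congr (_ + _); first by rewrite mulrCA.
by rewrite mulrA.
Qed.

(** The derivation is $u^2\,d/du$, which sends [u] to $u^2$ and so gives $vu = uv + u^2$. *)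
Definition jplane_data (k : fieldType) : ore_data k :=
  @OreData k idfun ('X^2 \*o @deriv k) (@jplane_leibniz k).

Lemma qplane_ore (k : fieldType) (q : k) :
  qplane_rel q (ore_u (qplane_data q)) (ore_v (qplane_data q)).
Proof.
rewrite /qplane_rel ore_vuE /= comp_polyX polyC0 addr0.
rewrite -[RHS]/(q%:P *: (ore_u _ * ore_v _ : {poly {poly k}})) ore_mul_uE scalerA.
by rewrite mul_polyC.
Qed.

Lemma jplane_ore (k : fieldType) :
  jplane_rel (ore_u (jplane_data k)) (ore_v (jplane_data k)).
Proof.
rewrite /jplane_rel ore_vuE /= derivX mulr1 -[RHS]/(_ + _ : {poly {poly k}}).
rewrite !ore_mul_uE; congr (_ + _).
by rewrite /ore_u -mul_polyC -polyCM.
Qed.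

Theorem mainTheorem3
  (k : closedFieldType) (k_char0 : [pchar k] =i pred0)
  (A : algType k) (u v : A) (n : nat) (w : k) (w_prim : n.-primitive_root w)
  (sigma : {lrmorphism A -> A}) :
  ( (exists (q : k) (a : nat),
       [/\ q != 0, q != 1, (1 <= a < n)%N, coprime a n
         & [/\ presented_by (qplane_rel q) u v,
               sigma u = w *: u & sigma v = w ^+ a *: v]])
    \/
    [/\ (2 <= n)%N, presented_by (@jplane_rel k) u v,
        sigma u = w *: u & sigma v = w *: v] ) ->
  quotient_fin_dim n sigma /\ auslander_iso n sigma.
Proof.
case=> [[q [a [q0 _ _ co [pres su sv]]]]|[_ pres su sv]].
  have vu : v * u = q *: (u * v) := pres.1.
  (* Normality of [u] is witnessed by $vu = u(qv)$ and $uv = (q^{-1}v)u$. *)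
  apply: (auslander_of_presented (D := qplane_data q) pres (qplane_ore q) _ q0 _
            w_prim co su sv (v1 := q *: v) (v2 := q^-1 *: v)).
  - by rewrite /= comp_polyX linearZ /= horner_algX rmorph0 addr0 mulr_algl vu scalerAl.
  - by rewrite /= comp_polyX.
  - by rewrite vu scalerAr.
  - by rewrite -scalerAl vu scalerA mulVf // scale1r.
have vu : v * u = u * v + u * u := pres.1.
(* Here [s] is the identity, so its scalar on ['X] is 1; normality reads $vu = u(v+u)$ and $uv =
   (v-u)u$. *)
apply: (auslander_of_presented (D := jplane_data k) (a := 1) pres (jplane_ore k) _
          (oner_neq0 k) _ w_prim _ su sv (v1 := v + u) (v2 := v - u)).
- by rewrite /= derivX mulr1 rmorphXn /= horner_algX vu.
- by rewrite /= scale1r.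
- exact: coprime1n.
- by rewrite mulrDr.
- by rewrite mulrBl vu addrK.
Qed.
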